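(* Let $\Omega\subset\mathbb R^d$ be a regular set with $\mu_d(\Omega)>0$ and let $f:\Omega\to\mathbb R$ be continuous almost everywhere with $\mathcal{ER}(f)$ connected. Take any closed $d$-dimensional rectangle $[\mathbf a,\mathbf b]\supseteq\Omega$, any $\mathbf n=\mathbf n(n)\in\mathbb N^d$ with $\mathbf n\to\infty$, and any asymptotically uniform grid $\{\mathbf x_{\mathbf i,\mathbf n}^{(n)}\}_{\mathbf i=\mathbf 1,\ldots,\mathbf n}$ in $[\mathbf a,\mathbf b]$. For every $n$, sort the samples $f(\mathbf x_{\mathbf i,\mathbf n}^{(n)})$, $\mathbf i\in\mathcal I_{\mathbf n}^{(n)}(\Omega)=\{\mathbf i\in\{\mathbf 1,\ldots,\mathbf n\}:\mathbf x_{\mathbf i,\mathbf n}^{(n)}\in\Omega\}$, increasingly into $[s_0,\ldots,s_{\omega(n)}]$ with $\omega(n)=|\mathcal I_{\mathbf n}^{(n)}(\Omega)|-1$, and let $f^\dagger_n:[0,1]\to\mathbb R$ be the linear spline interpolating $s_0,\ldots,s_{\omega(n)}$ at the nodes $0,\frac1{\omega(n)},\ldots,1$. Then: 1. $f^\dagger_n\to f^\dagger$ uniformly on every compact interval $[\alpha,\beta]\subset(0,1)$; 2. if $f$ is bounded from below on $\Omega$ with $\inf_\Omega f=\operatorname{ess\,inf}_\Omega f$, then $f_n^\dagger\to f^\dagger$ uniformly on every compact interval $[0,\alpha]\subset[0,1)$; 3. if $f$ is bounded from above on $\Omega$ with $\sup_\Omega f=\operatorname{ess\,sup}_\Omega f$,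 then $f_n^\dagger\to f^\dagger$ uniformly on every compact interval $[\alpha,1]\subset(0,1]$; 4. if $f$ is bounded on $\Omega$ and $\mathcal{ER}(f)=[\inf_\Omega f,\sup_\Omega f]$, then $f_n^\dagger\to f^\dagger$ uniformly on $[0,1]$.
   Context: $\Omega\subset\mathbb R^d$ is regular if bounded with $\mu_d(\partial\Omega)=0$. $\mathcal{ER}(f)=\{z\in\mathbb R:\mu_d\{\mathbf x\in\Omega:|f(\mathbf x)-z|<\epsilon\}>0\ \forall\epsilon>0\}$, $\operatorname{ess\,inf}_\Omega f=\inf\mathcal{ER}(f)$, $\operatorname{ess\,sup}_\Omega f=\sup\mathcal{ER}(f)$. Monotone rearrangement: $f^\dagger(y)=\inf\{u\in\mathbb R:\mu_d\{f\le u\}/\mu_d(\Omega)\ge y\}$ for $y\in(0,1)$, extended by $f^\dagger(0)=\operatorname{ess\,inf}_\Omega f$ when this is $>-\infty$ and $f^\dagger(1)=\operatorname{ess\,sup}_\Omega f$ when this is $<\infty$. Multi-index notation: $\mathbf n\to\infty$ means $\min_j n_j\to\infty$; $\{\mathbf 1,\ldots,\mathbf n\}=\{\mathbf i\in\mathbb Z^d:\mathbf 1\le\mathbf i\le\mathbf n\}$; operations componentwise. The grid is asymptotically uniform in $[\mathbf a,\mathbf b]$ if $\max_{\mathbf i}\|\mathbf x_{\mathbf i,\mathbf n}^{(n)}-(\mathbf a+\mathbf i(\mathbf b-\mathbf a)/\mathbf n)\|_\infty\to0$. *)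

(* Defs.v *)
From HB Require Import structures.
From mathcomp Require Import all_boot all_order all_algebra.
From mathcomp Require Import all_classical all_reals all_analysis.
Set Implicit Arguments. Unset Strict Implicit. Unset Printing Implicit Defensive.
Import Order.TTheory GRing.Theory Num.Theory.
Import numFieldNormedType.Exports.
Local Open Scope classical_set_scope.
Local Open Scope ring_scope.

Definition rbox {R : realType} {d : nat} (a b : 'rV[R]_d) : set 'rV[R]_d :=
  [set x | forall j : 'I_d, a ord0 j <= x ord0 j <= b ord0 j].

Definition rvol {R : realType} {d : nat} (a b : 'rV[R]_d) : R :=
  \prod_(j < d) Num.max 0 (b ord0 j - a ord0 j).

(* d-dimensional Lebesgue (outer) measure mu_d: infimum of total volumes of
   countable coverings by closed boxes.  On Lebesgue measurable sets this is
   the Lebesgue measure. *)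
Definition leb {R : realType} {d : nat} (A : set 'rV[R]_d) : \bar R :=
  ereal_inf [set s : \bar R | exists a b : nat -> 'rV[R]_d,
     A `<=` \bigcup_k rbox (a k) (b k) /\
     s = (\sum_(0 <= k <oo) (rvol (a k) (b k))%:E)%E].

Definition regular_set {R : realType} {d : nat} (O : set 'rV[R]_d) : Prop :=
  bounded_set O /\ leb (closure O `\` interior O) = 0%E.

Definition cont_at_in {R : realType} {d : nat} (O : set 'rV[R]_d)
  (f : 'rV[R]_d -> R) (x : 'rV[R]_d) : Prop :=
  f @ within O (nbhs x) --> f x.

Definition cont_ae {R : realType} {d : nat} (O : set 'rV[R]_d)
  (f : 'rV[R]_d -> R) : Prop :=
  leb [set x | O x /\ ~ cont_at_in O f x] = 0%E.

Definition ER {R : realType} {d : nat} (O : set 'rV[R]_d) (f : 'rV[R]_d -> R)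
  : set R :=
  [set z | forall e : R, 0 < e -> (0 < leb [set x | O x /\ (`|f x - z| < e)%R])%E].

Definition ess_inf {R : realType} {d : nat} (O : set 'rV[R]_d)
  (f : 'rV[R]_d -> R) : \bar R := ereal_inf [set z%:E | z in ER O f].

Definition ess_sup {R : realType} {d : nat} (O : set 'rV[R]_d)
  (f : 'rV[R]_d -> R) : \bar R := ereal_sup [set z%:E | z in ER O f].

(* monotone rearrangement f^dagger on [0,1]; at 0 and 1 it is the essential
   inf/sup (only meaningful/used when these are finite) *)
Definition fdag {R : realType} {d : nat} (O : set 'rV[R]_d)
  (f : 'rV[R]_d -> R) (y : R) : R :=
  if y == 0 then fine (ess_inf O f)
  else if y == 1 then fine (ess_sup O f)
  else inf [set u : R |
    y <= fine (leb [set x | O x /\ f x <= u]) / fine (leb O)].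

Definition lin_spline {R : realType} (s : seq R) (y : R) : R :=
  let w := (size s).-1 in
  let t := y * w%:R in
  let m := minn (Num.truncn t) w.-1 in
  s`_m + (t - m%:R) * (s`_m.+1 - s`_m).

(* multi-indices i in {1,...,n}: the value of the j-th component is (i j).+1 *)
Notation multi_idx d n := {dffun forall j : 'I_d, 'I_(n j)}.

Definition sorted_samples {R : realType} {d : nat} (n : 'I_d -> nat)
  (O : set 'rV[R]_d) (f : 'rV[R]_d -> R) (x : multi_idx d n -> 'rV[R]_d)
  : seq R :=
  sort <=%R [seq f (x i) | i <- enum [set: multi_idx d n] & `[< O (x i) >]].

(* Main.v *)
Require Import Defs.
From HB Require Import structures.
From mathcomp Require Import all_boot all_order all_algebra.
From mathcomp Require Import all_classical all_reals all_analysis.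
From mathcomp Require Import ring lra zify.
Import Order.TTheory GRing.Theory Num.Theory.
Import numFieldNormedType.Exports.
Local Open Scope classical_set_scope.
Local Open Scope ring_scope.

(** Write F(u) = mu{f <= u} / mu(Omega).  If mu{f = u} = 0, the boundary of
    {f <= u} lies in the null set made of the boundary of Omega, the
    discontinuities of f and {f = u}; the fraction of grid points falling in a
    set with null boundary converges to its relative measure, hence the
    empirical distribution function of the samples converges to F(u).  The upper
    half of that statement holds for compact sets (cover by finitely many boxes
    and count in each box), the lower half for open sets by complementation.
    Only countably many u are atoms.  Connectedness of ER(f) makes F strictly
    increasing where 0 < F < 1, so for 0 < y < 1 there are non-atoms u < v,
    arbitrarily close to each other, with F(u) < y < F(v).  These inequalities
    persist near y and force both fn(y') and fdag(y') into [u, v] for y' close to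
    y and n large.  At y = 0 (resp. 1) one of the two barriers is replaced by
    inf f = ess inf f (resp. sup f = ess sup f).  Thus fn converges locally
    uniformly, and a compact interval needs finitely many such neighbourhoods. *)

(** * The outer measure [leb] *)

Section Lebesgue.
Context {R : realType} {d : nat}.
Implicit Types (p q a b : 'rV[R]_d) (A X : set 'rV[R]_d).

Lemma rvol_ge0 p q : 0 <= rvol p q.
Proof. by apply: prodr_ge0 => j _; rewrite le_max lexx. Qed.

Lemma rvol_series_ge0 (a b : nat -> 'rV[R]_d) :
  (0 <= \sum_(0 <= k <oo) (rvol (a k) (b k))%:E)%E.
Proof. by apply: nneseries_ge0 => k _ _; rewrite lee_fin rvol_ge0. Qed.

Lemma leb_cover_le A (a b : nat -> 'rV[R]_d) :
  A `<=` \bigcup_k rbox (a k) (b k) ->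
  (leb A <= \sum_(0 <= k <oo) (rvol (a k) (b k))%:E)%E.
Proof. by move=> Aab; apply: ereal_inf_lbound; exists a, b. Qed.

Lemma leb_ge0 A : (0 <= leb A)%E.
Proof. by apply: le_ereal_inf_tmp => _ [a [b [_ ->]]]; exact: rvol_series_ge0. Qed.

Lemma le_leb : {homo @leb R d : A B / A `<=` B >-> (A <= B)%E}.
Proof.
move=> A B AB; apply/ereal_inf_le_tmp => _ [a [b [Bab ->]]].
by exists a, b; split => //; exact: subset_trans Bab.
Qed.

(** The two corner sequences form a pair, so that [choice] can select covers for a whole sequence of
    sets at once. *)
Lemma leb_cover_adherent A (e : R) : (leb A < +oo)%E -> 0 < e ->
  exists ab : (nat -> 'rV[R]_d) * (nat -> 'rV[R]_d),
    A `<=` \bigcup_k rbox (ab.1 k) (ab.2 k) /\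
    (\sum_(0 <= k <oo) (rvol (ab.1 k) (ab.2 k))%:E <= leb A + e%:E)%E.
Proof.
move=> Aoo e0; have Afin : leb A \is a fin_num by rewrite ge0_fin_numE ?leb_ge0.
have [_ [a [b [Aab ->]]] /ltW le_e] := lb_ereal_inf_adherent e0 Afin.
by exists (a, b).
Qed.

(** Covers of the [F n], each optimal up to [e / 2 ^ n.+1], are merged into one cover along a
    bijection between [nat] and [nat * nat]. *)
Lemma leb_sigma_subadditive : sigma_subadditive (@leb R d).
Proof.
move=> F; have [[i Fi]|] := pselect (exists i, leb (F i) = +oo%E).
  by rewrite (eseries_pinfty _ _ Fi) ?leey// => n _; rewrite -ltNye (lt_le_trans _ (leb_ge0 _)).
rewrite -forallNE => Foo.
apply/lee_addgt0Pr => e e0.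
have tr := @epsilon_trick _ (fun n => leb (F n)) e xpredT (fun n => leb_ge0 (F n)) (ltW e0).
apply: le_trans tr.
have cover n := @leb_cover_adherent (F n) (e / (2 ^ n.+1)%:R).
have {cover}/choice[ab abP] n := cover n ltac:(by rewrite ltey; apply/eqP)
  ltac:(by rewrite divr_gt0// ltr0n expn_gt0).
pose v n m := (rvol ((ab n).1 m) ((ab n).2 m))%:E.
have v0 n m : (0 <= v n m)%E by rewrite lee_fin rvol_ge0.
have /ppcard_eqP[g] : ([set: nat] #= [set: nat * nat])%card
  by rewrite card_eq_sym card_nat2.
apply: (@le_trans _ _ (\sum_(0 <= k <oo) v (g k).1 (g k).2)%E).
  apply: leb_cover_le => x [n _ /(abP n).1[m _ xnm]].
  by exists (g^-1%FUN (n, m)) => //=; rewrite invK ?inE.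
rewrite nneseries_esumT => [|k]; last exact: v0.
rewrite -(@reindex_esum _ _ _ setT setT g (fun k => v k.1 k.2)) //.
rewrite [leLHS](_ : _ = \esum_(k in [set: nat] `*`` fun=> setT) v k.1 k.2).
  rewrite -esum_esum// -nneseries_esumT => [|n]; last by apply: esum_ge0.
  apply: lee_nneseries => [n _ _|n _]; first exact: esum_ge0.
  by rewrite -nneseries_esumT//; exact: (abP n).2.
by congr esum; apply/seteqP; split.
Qed.

End Lebesgue.

Section LebesgueMeasure.
Context {R : realType} {d : nat}.
Local Notation rV := 'rV[R]_d.+1.

(** The product has at least one factor here. Degenerate boxes thus pad finite covers to infinite
    ones at no cost. *)
Lemma rvol_degenerate (p : rV) : rvol p p = 0.
Proof. by rewrite /rvol big_ord_recl subrr maxxx mul0r. Qed.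

Lemma leb_rbox_le (p q : rV) : (leb (rbox p q) <= (rvol p q)%:E)%E.
Proof.
pose b k : rV := if k is 0%N then q else p.
apply: (@le_trans _ _ (\sum_(0 <= k <oo) (rvol p (b k))%:E)%E).
  by apply: (@leb_cover_le _ _ _ (fun=> p) b) => x px; exists 0%N.
rewrite nneseries_recl//=; last by move=> k _; rewrite lee_fin rvol_ge0.
rewrite eseries0 ?adde0// => -[|k] _ _ //=.
by rewrite rvol_degenerate.
Qed.

Lemma leb0 : leb (set0 : set rV) = 0%E.
Proof.
apply/eqP; rewrite eq_le leb_ge0 andbT.
have := leb_rbox_le 0 0; rewrite rvol_degenerate; apply: le_trans.
exact: le_leb.
Qed.

End LebesgueMeasure.

(** Gives access to Carathéodory's theorem: the measurable sets form a sigma-algebra on which [leb]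
    is a measure. *)
HB.instance Definition _ (R : realType) (d : nat) :=
  isOuterMeasure.Build R 'rV[R]_d.+1 (@leb R d.+1)
    leb0 leb_ge0 le_leb leb_sigma_subadditive.

(** * Carathéodory measurability of boxes, open sets and null sets *)

Section LebesgueMeasurable.
Context {R : realType} {d : nat}.
Local Notation rV := 'rV[R]_d.+1.
Local Notation leb := (@leb R d.+1).
Implicit Types A B X : set rV.

Definition set_coord (j : 'I_d.+1) (c : R) (p : rV) : rV :=
  \row_i if i == j then c else p ord0 i.

(* [rbox p q] is cut along the hyperplane [x_j = c]. *)
Lemma rvol_split (j : 'I_d.+1) (c : R) (p q : rV) :
  rvol p (set_coord j (Num.min (q ord0 j) c) q) +
  rvol (set_coord j (Num.max (p ord0 j) c) p) q = rvol p q.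
Proof.
rewrite /rvol (bigD1 j) //= [X in _ + X](bigD1 j) //= [RHS](bigD1 j) //=.
rewrite !mxE eqxx.
rewrite (eq_bigr (fun i => Num.max 0 (q ord0 i - p ord0 i))); last first.
  by move=> i /negbTE ij; rewrite mxE ij.
rewrite [X in _ + _ * X](eq_bigr (fun i => Num.max 0 (q ord0 i - p ord0 i))); last first.
  by move=> i /negbTE ij; rewrite mxE ij.
rewrite -mulrDl; congr (_ * _).
by rewrite /Num.min /Num.max; do ![case: ifPn]; rewrite -?leNgt; lra.
Qed.

(** Every box of a cover is cut at [x_j = c] without changing the total volume. Both closed halves
    contain the cutting hyperplane, so [A] may contain any part of it; this treats open and closed
    half-spaces together. *)
Lemma caratheodory_slab (j : 'I_d.+1) (c : R) A :
  [set x : rV | x ord0 j < c] `<=` A -> A `<=` [set x : rV | x ord0 j <= c] ->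
  leb.-caratheodory A.
Proof.
move=> ltA Ale; apply: le_caratheodory_measurable => X.
apply: le_ereal_inf_tmp => _ [a [b [Xab ->]]].
pose b' k := set_coord j (Num.min (b k ord0 j) c) (b k).
pose a' k := set_coord j (Num.max (a k ord0 j) c) (a k).
rewrite [leRHS](_ : _ = \sum_(0 <= k <oo) (rvol (a k) (b' k))%:E +
                        \sum_(0 <= k <oo) (rvol (a' k) (b k))%:E)%E; last first.
  rewrite -nneseriesD//; [|by move=> k _ _; rewrite lee_fin rvol_ge0..].
  by apply: eq_eseriesr => k _; rewrite -EFinD rvol_split.
apply: leeD; apply: leb_cover_le => x [/Xab[k _ xk]].
- move=> /Ale xc; exists k => // i; rewrite mxE.
  by case: eqP => [->|_]; rewrite ?le_min ?xc ?andbT; exact: xk.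
- move=> Ax; have cx : c <= x ord0 j by rewrite leNgt; apply/negP => /ltA.
  exists k => // i; rewrite mxE.
  by case: eqP => [->|_]; rewrite ?ge_max ?cx ?andbT; exact: xk.
Qed.

Lemma caratheodory_countable_bigcup (T : countType) (F : T -> set rV) :
  (forall t, leb.-caratheodory (F t)) -> leb.-caratheodory (\bigcup_t F t).
Proof.
move=> mF.
exact: (@countable_bigcupT_measurable _ (caratheodory_type leb)).
Qed.

Lemma caratheodory_rbox (p q : rV) : leb.-caratheodory (rbox p q).
Proof.
have -> : rbox p q = ~` \bigcup_j ([set x : rV | x ord0 j < p ord0 j] `|`
                                  ~` [set x : rV | x ord0 j <= q ord0 j]).
  apply/seteqP; split=> [x pq [j _ []]|x npq j] /=.
  - by rewrite ltNge; case/andP: (pq j) => ->.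
  - by case/andP: (pq j).
  - apply/andP; split; rewrite leNgt; apply/negP => xj; apply: npq; exists j => //.
    + by left.
    + by right; apply/negP; rewrite -ltNge.
apply: caratheodory_measurable_setC; apply: caratheodory_countable_bigcup => j.
apply: caratheodory_measurable_setU.
  by apply: (@caratheodory_slab j (p ord0 j)) => // x /ltW.
apply: caratheodory_measurable_setC.
by apply: (@caratheodory_slab j (q ord0 j)) => // x /ltW.
Qed.

Lemma compact_rbox (p q : rV) : compact (rbox p q).
Proof.
have -> : rbox p q = [set v : rV | forall j, [set` `[p ord0 j, q ord0 j]] (v ord0 j)].
  by apply/seteqP; split => v vpq j; have := vpq j; rewrite /= in_itv.
apply: (@rV_compact R d.+1 (fun j => [set` `[p ord0 j, q ord0 j]])) => j.
exact: segment_compact.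
Qed.

Lemma nbhs_rbox (x : rV) (e : R) : 0 < e ->
  nbhs x (rbox (\row_j (x ord0 j - e)) (\row_j (x ord0 j + e))).
Proof.
move=> e0; apply/nbhs_ballP; exists e => //= y [_ xy] j; rewrite !mxE.
by have := xy ord0 j; rewrite /ball /= => /ltW; rewrite ler_norml; lra.
Qed.

Lemma nbhs_rboxP (x : rV) A : nbhs x A ->
  exists2 e : R, 0 < e &
    forall y : rV, (forall j, `|x ord0 j - y ord0 j| < e) -> A y.
Proof.
move=> /nbhs_ballP[e /= e0 eA]; exists e => // y xy; apply: eA; split => // i j.
by rewrite ord1; exact: xy.
Qed.

Lemma caratheodory_open A : open A -> leb.-caratheodory A.
Proof.
move=> oA.
pose box (t : 'rV[rat]_d.+1 * nat) : set rV :=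
  rbox (\row_j (ratr (t.1 ord0 j) - t.2.+1%:R^-1))
       (\row_j (ratr (t.1 ord0 j) + t.2.+1%:R^-1)).
have -> : A = \bigcup_t (if `[< box t `<=` A >] then box t else set0).
  apply/seteqP; split=> [x Ax|x [t _]]; last by case: asboolP => // /[apply].
  have [e e0 eA] := nbhs_rboxP _ _ (open_nbhs_nbhs (conj oA Ax)).
  (* In every coordinate the rational centre is chosen within [n.+1%:R^-1] of [x], so the box
     contains [x] and all its points stay within [2 / n.+1 < e] of [x]. *)
  have [n /= n_e] : exists n : nat, n.+1%:R^-1 < e / 2.
    have := near_infty_natSinv_lt (PosNum (divr_gt0 e0 (ltr0n R 2))).
    by case=> n _ /(_ n (leqnn n)); exists n.
  have n0 : 0 < n.+1%:R^-1 :> R by rewrite invr_gt0.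
  have rP j : exists r : rat, x ord0 j - n.+1%:R^-1 < ratr r < x ord0 j.
    have [|r] := @rat_in_itvoo _ (x ord0 j - n.+1%:R^-1) (x ord0 j).
      by rewrite ltrBlDr ltrDl.
    by rewrite in_itv /=; exists r.
  have {rP}/choice[r rP] := rP.
  exists (\row_j r j, n) => //; case: asboolP => [_ j|[]] /=.
    by rewrite !mxE; have /andP[] := rP j; move: n0; set u := _^-1; lra.
  move=> y yb; apply: eA => j; have := yb j; rewrite !mxE /= ltr_norml.
  by have /andP[] := rP j; move: n_e n0; set u := _^-1; lra.
apply: caratheodory_countable_bigcup => t; case: asboolP => _.
  exact: caratheodory_rbox.
exact: caratheodory_measurable_set0.
Qed.

Lemma caratheodory_null A : leb A = 0%E -> leb.-caratheodory A.
Proof.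
move=> A0; apply: le_caratheodory_measurable => X.
rewrite -[leRHS]add0e; apply: leeD; last by apply: le_leb; exact: subIsetl.
by rewrite -A0; apply: le_leb; exact: subIsetr.
Qed.

Lemma leb_null_sub A B : A `<=` B -> leb B = 0%E -> leb A = 0%E.
Proof. by move=> AB B0; apply/eqP; rewrite eq_le leb_ge0 andbT -B0 le_leb. Qed.

Lemma leb_nullU A B : leb A = 0%E -> leb B = 0%E -> leb (A `|` B) = 0%E.
Proof.
move=> A0 B0; apply/eqP; rewrite eq_le leb_ge0 andbT.
have : (leb (A `|` B) <= leb A + leb B)%E := outer_measureU2 leb A B.
by rewrite A0 B0 adde0.
Qed.

Lemma leb_null_bigcup (T : countType) (F : T -> set rV) :
  (forall t, leb (F t) = 0%E) -> leb (\bigcup_t F t) = 0%E.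
Proof.
move=> F0; pose G n := if @unpickle T n is Some t then F t else set0.
apply: (@leb_null_sub _ (\bigcup_n G n)).
  by move=> x [t _ Ftx]; exists (pickle t) => //; rewrite /G pickleK.
apply/eqP; rewrite eq_le leb_ge0 andbT.
apply: le_trans (outer_measure_sigma_subadditive leb G) _.
rewrite eseries0// => n _ _; rewrite /G; case: unpickle => //; exact: leb0.
Qed.

Lemma leb_diff A B : leb.-caratheodory A -> A `<=` B ->
  leb B = (leb A + leb (B `\` A))%E.
Proof. by move=> mA AB; rewrite (mA B) (setIidr AB) setDE. Qed.

End LebesgueMeasurable.

(** * Counting grid points *)

Lemma card_multi_idx (d : nat) (n : 'I_d -> nat) :
  #|{: multi_idx d n}| = (\prod_j n j)%N.
Proof.
rewrite card_dep_ffun foldrE /image_mem big_map big_enum /=.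
by apply: eq_bigr => j _; rewrite card_ord.
Qed.

(** All indices satisfying [P] lie between the least and the greatest of them, which differ by at
    most [len]. *)
Lemma card_ord_interval (R : realType) (n : nat) (P : pred 'I_n) (lo len : R) :
  0 <= len -> (forall i : 'I_n, P i -> lo <= i%:R <= lo + len) ->
  #|P|%:R <= len + 1.
Proof.
move=> len0 Plen; case: (pickP P) => [i0 Pi0|P0]; last first.
  by rewrite (eq_card0 P0) addr_ge0.
pose im := [arg min_(i < i0 | P i) (i : nat)].
pose iM := [arg max_(i > i0 | P i) (i : nat)].
have [Pm lem] : P im /\ forall i, P i -> (im <= i)%N.
  by rewrite /im; case: arg_minnP.
have [PM geM] : P iM /\ forall i, P i -> (i <= iM)%N.
  by rewrite /iM; case: arg_maxnP.
have : (#|P| <= (iM - im).+1)%N.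
  rewrite cardE -(size_map val) -(size_iota im (iM - im).+1).
  apply: uniq_leq_size.
    by rewrite map_inj_uniq ?enum_uniq//; exact: val_inj.
  move=> m /mapP[i]; rewrite mem_enum => Pi ->; rewrite mem_iota.
  by have := lem _ Pi; have := geM _ Pi; rewrite /=; lia.
rewrite -(ler_nat R) => /le_trans; apply; rewrite -natr1 lerD2r.
rewrite natrB; last exact: lem.
by have := Plen _ Pm; have := Plen _ PM; lra.
Qed.

(** Continuity of the product at [h = 0]. It bounds the cost of enlarging a box. *)
Lemma prodr_enlarge (R : realType) (d : nat) (c : 'I_d -> R) (e : R) : 0 < e ->
  exists2 h : R, 0 < h & \prod_j (c j + h) <= \prod_j c j + e.
Proof.
move=> e0.
have : (fun h : R => \prod_j (c j + h)) @ (0 : R) --> \prod_j (c j + 0).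
  apply: cvg_big => [|j _]; first exact: mul_continuous.
  by apply: cvgD; [exact: cvg_cst|exact: cvg_id].
under [X in _ --> X]eq_bigr do rewrite addr0.
move=> /cvgr_lt/(_ (\prod_j c j + e)); rewrite ltrDl => /(_ e0).
move=> /nbhs_ballP[r /= r0 rP]; exists (r / 2); first by rewrite divr_gt0.
apply/ltW/rP; rewrite /ball /= sub0r normrN ger0_norm; lra.
Qed.

Definition grid_count {R : realType} {d : nat} {n : 'I_d -> nat}
  (x : multi_idx d n -> 'rV[R]_d) (E : set 'rV[R]_d) : nat :=
  #|[pred i | `[< E (x i) >]]|.

Section GridCount.
Context {R : realType} {d : nat} {n : 'I_d -> nat}
  (x : multi_idx d n -> 'rV[R]_d).
Implicit Types E F : set 'rV[R]_d.

Lemma grid_count_subset E F : E `<=` F -> (grid_count x E <= grid_count x F)%N.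
Proof.
move=> EF; apply: subset_leq_card. apply/fintype.subsetP => i.
by rewrite !unfold_in /= => /asboolP Ei; apply/asboolP/EF.
Qed.

Lemma grid_countU E F :
  (grid_count x (E `|` F) <= grid_count x E + grid_count x F)%N.
Proof.
rewrite /grid_count -cardUI; apply: leq_trans (leq_addr _ _).
apply: subset_leq_card; apply/fintype.subsetP => i.
by rewrite !unfold_in /= => /asboolP[?|?]; apply/orP; [left|right]; apply/asboolP.
Qed.

Lemma grid_count_bigcup (m : nat) (E : nat -> set 'rV[R]_d) :
  (grid_count x (\bigcup_(k < m) E k) <= \sum_(k < m) grid_count x (E k))%N.
Proof.
rewrite bigcup_mkord; elim: m => [|m IH].
  rewrite !big_ord0 /grid_count eq_card0// => i.
  by rewrite !unfold_in /=; apply/asboolP.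
rewrite !big_ord_recr /=; apply: leq_trans (grid_countU _ _) _.
by rewrite leq_add2r.
Qed.

Lemma grid_countC E : (grid_count x E + grid_count x (~` E) = \prod_j n j)%N.
Proof.
rewrite -card_multi_idx -(cardC [pred i | `[< E (x i) >]]); congr (_ + _)%N.
by apply: eq_card => i; rewrite !unfold_in /= asbool_neg.
Qed.

(* A coordinate of an index counted in the box ranges over an interval of
   length (q_j - p_j + 2 h) n_j / (b_j - a_j). *)
Lemma grid_count_rbox_le (a b p q : 'rV[R]_d) (h : R) :
  (forall j, a ord0 j < b ord0 j) -> (forall j, (0 < n j)%N) -> 0 <= h ->
  (forall i j, `|x i ord0 j - (a ord0 j + (i j).+1%:R * (b ord0 j - a ord0 j)
                                    / (n j)%:R)| <= h) ->
  rvol a b * (grid_count x (rbox p q))%:R <=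
  \prod_j (Num.max 0 (q ord0 j - p ord0 j) + (2 * h + (b ord0 j - a ord0 j) / (n j)%:R))
  * (\prod_j n j)%:R.
Proof.
move=> ab n0 h0 xh.
pose L j := b ord0 j - a ord0 j.
have L0 j : 0 < L j by rewrite subr_gt0.
have nR j : 0 < (n j)%:R :> R by rewrite ltr0n.
(* The indices whose uniform node is within [h] of the [j]-th side of the box. An index counted in
   the box has all its components in these sets, hence the bound by a product of cardinals. *)
pose F j : pred 'I_(n j) := [pred m : 'I_(n j) |
  p ord0 j - h <= a ord0 j + m.+1%:R * L j / (n j)%:R <= q ord0 j + h].
have leF : (grid_count x (rbox p q) <= \prod_j #|F j|)%N.
  have -> : (\prod_j #|F j|)%N = #|(family F : simpl_pred (multi_idx d n))|.
    by rewrite card_family foldrE /image_mem big_map big_enum.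
  apply: subset_leq_card; apply/fintype.subsetP => i.
  rewrite [X in is_true X -> _]unfold_in /= => /asboolP xpq.
  apply/familyP => j; rewrite unfold_in /=.
  have := xpq j; have := xh i j; rewrite -/(L j) ler_norml.
  by move: (x i ord0 j) (a ord0 j + _) => u v; lra.
have -> : rvol a b = \prod_j L j.
  by apply: eq_bigr => j _; rewrite max_r// ltW// L0.
rewrite -(ler_nat R) in leF.
apply: le_trans (ler_wpM2l _ leF) _; first by apply: prodr_ge0 => j _; exact/ltW.
rewrite !natr_prod -!big_split /=; apply: ler_prod => j _.
rewrite mulr_ge0 ?(ltW (L0 j))//=.
have -> : (Num.max 0 (q ord0 j - p ord0 j) + (2 * h + (b ord0 j - a ord0 j) / (n j)%:R))
    * (n j)%:R = L j * ((Num.max 0 (q ord0 j - p ord0 j) + 2 * h) * (n j)%:R / L j + 1).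
  by rewrite -/(L j); field; rewrite !gt_eqF.
rewrite ler_pM2l//.
have M0 : 0 <= Num.max 0 (q ord0 j - p ord0 j) by rewrite le_max lexx.
(* This is the lower bound in [F j] solved for [m.+1]; the final [- 1] passes from [m.+1] to [m]. *)
apply: (@card_ord_interval _ _ _ ((p ord0 j - h - a ord0 j) * (n j)%:R / L j - 1)).
  by rewrite divr_ge0 ?(ltW (L0 j))// mulr_ge0// addr_ge0// mulr_ge0.
move=> m Fm; rewrite lerBlDr [_ - 1 + _]addrAC lerBrDr natr1.
rewrite -mulrDl -mulrDl ler_pdivrMr// ler_pdivlMr//.
have qM : q ord0 j - p ord0 j <= Num.max 0 (q ord0 j - p ord0 j).
  by rewrite le_max lexx orbT.
rewrite -[m.+1%:R * L j](divfK (lt0r_neq0 (nR j))) !ler_pM2r//.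
case/andP: Fm; set u := _ / _ => F1 F2. apply/andP; split; lra.
Qed.

End GridCount.

(** * Asymptotic density of the grid in compact sets, open sets and sets with null boundary *)

Section GridDensity.
Context {R : realType} {d : nat} (a b : 'rV[R]_d.+1)
  (nn : nat -> 'I_d.+1 -> nat)
  (x : forall k : nat, multi_idx d.+1 (nn k) -> 'rV[R]_d.+1).
Local Notation leb := (@leb R d.+1).
Implicit Types (p q : 'rV[R]_d.+1) (E F K U : set 'rV[R]_d.+1).
Hypothesis ab : forall j, a ord0 j < b ord0 j.
Hypothesis nn_oo : forall (j : 'I_d.+1) (M : nat),
  exists K : nat, forall k : nat, (K <= k)%N -> (M <= nn k j)%N.
Hypothesis x_unif : forall e : R, 0 < e -> exists K : nat, forall k : nat,
  (K <= k)%N -> forall (i : multi_idx d.+1 (nn k)) (j : 'I_d.+1),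
    `|x k i ord0 j - (a ord0 j + (i j).+1%:R * (b ord0 j - a ord0 j)
                                    / (nn k j)%:R)| <= e.

Local Notation cnt k E := ((grid_count (x k) E)%:R : R).
Local Notation N k := ((\prod_j nn k j)%N%:R : R).

Lemma near_nn_large (M : nat) : \forall k \near \oo, forall j, (M <= nn k j)%N.
Proof.
have /choice[K KP] j := nn_oo j M.
near=> k => j; apply: KP; apply: leq_trans (leq_bigmax j) _.
by near: k; exact: nbhs_infty_ge.
Unshelve. all: by end_near. Qed.

Lemma near_grid_rbox_count (c d' : 'rV[R]_d.+1) (e : R) : 0 < e ->
  \forall k \near \oo, rvol a b * cnt k (rbox c d') <= (rvol c d' + e) * N k.
Proof.
move=> e0.
have [h h0 hP] := prodr_enlarge _ _ (fun j => Num.max 0 (d' ord0 j - c ord0 j)) _ e0.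
(* The enlargement [h] of each factor is split in two: [2 * (h / 4)] for the deviation of the grid,
   and [h / 2] for [(b_j - a_j) / n_j]. *)
have h40 : 0 < h / 4 by rewrite divr_gt0.
have [K KP] := x_unif _ h40.
(* The sum dominates each of its terms, so one [M] serves all coordinates. *)
pose M := (Num.truncn (\sum_j (b ord0 j - a ord0 j) * (2 / h))).+1.
near=> k.
have nM j : (M <= nn k j)%N by move: j; near: k; exact: near_nn_large.
have n0 j : (0 < nn k j)%N by apply: leq_trans (nM j).
have Kk : (K <= k)%N by near: k; exact: nbhs_infty_ge.
apply: le_trans (grid_count_rbox_le _ _ _ _ _ _ ab n0 (ltW h40) (KP _ Kk)) _.
rewrite ler_wpM2r// (le_trans _ hP)//; apply: ler_prod => j _.
have L0 : 0 < b ord0 j - a ord0 j by rewrite subr_gt0.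
have M0 : 0 <= Num.max 0 (d' ord0 j - c ord0 j) by rewrite le_max lexx.
have nR : 0 < (nn k j)%:R :> R by rewrite ltr0n.
apply/andP; split.
  by rewrite addr_ge0// addr_ge0 ?divr_ge0 ?(ltW L0)// mulr_ge0// ltW.
rewrite lerD2l -lerBrDl ler_pdivrMr//.
have : (b ord0 j - a ord0 j) * (2 / h) <= (nn k j)%:R.
  apply: (@le_trans _ _ M%:R); last by rewrite ler_nat.
  apply: le_trans (ltW (truncnS_gt _)).
  rewrite (bigD1 j) //= lerDl; apply: sumr_ge0 => i _.
  by rewrite mulr_ge0 ?divr_ge0 ?(ltW h0)// subr_ge0 ltW.
rewrite -(ler_pM2l (h0 : 0 < h)).
have -> : h * ((b ord0 j - a ord0 j) * (2 / h)) = 2 * (b ord0 j - a ord0 j).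
  by field; rewrite gt_eqF.
lra.
Unshelve. all: by end_near. Qed.

(** Three errors of [e / 3]: the choice of a nearly optimal cover, the enlargement of its boxes to
    neighbourhoods of their points, and the counting in the finitely many boxes kept by
    compactness. *)
Lemma near_grid_compact_count K (e : R) : compact K -> (leb K < +oo)%E -> 0 < e ->
  \forall k \near \oo, rvol a b * cnt k K <= (fine (leb K) + e) * N k.
Proof.
move=> cK Koo e0.
have e30 : 0 < e / 3 by rewrite divr_gt0.
have [[p q] /= [Kpq pqe]] := leb_cover_adherent _ _ Koo e30.
have /choice[h hP] m : exists h : R, 0 < h /\
    \prod_j (Num.max 0 (q m ord0 j - p m ord0 j) + h) <=
    rvol (p m) (q m) + e / 3 / (2 ^ m.+1)%:R.
  have em : 0 < e / 3 / (2 ^ m.+1)%:R by rewrite divr_gt0// ltr0n expn_gt0.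
  by have [h] := prodr_enlarge _ _ (fun j => Num.max 0 (q m ord0 j - p m ord0 j)) _ em; exists h.
pose p' m : 'rV[R]_d.+1 := \row_j (p m ord0 j - h m / 2).
pose q' m : 'rV[R]_d.+1 := \row_j (q m ord0 j + h m / 2).
have rvol' m : rvol (p' m) (q' m) <= rvol (p m) (q m) + e / 3 / (2 ^ m.+1)%:R.
  apply: le_trans (hP m).2; apply: ler_prod => j _; rewrite !mxE.
  have h0 := (hP m).1.
  by rewrite /Num.max; do 2?[case: ifPn]; rewrite -?leNgt; lra.
have sub_box m z : rbox (p m) (q m) z -> nbhs z (rbox (p' m) (q' m)).
  move=> zpq; have h20 : 0 < h m / 2 by rewrite divr_gt0// (hP m).1.
  apply: filterS (nbhs_rbox z _ h20) => y yz j.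
  by have := zpq j; have := yz j; rewrite !mxE; lra.
(* Compactness in its near-covering form: each point of [K] has some enlarged box as a
   neighbourhood, and this box is among the first [l] ones for [l] large. *)
have [M _ MP] : \forall m \near \oo, K `<=` \bigcup_(k < m) rbox (p' k) (q' k).
  apply: (iffLR (compact_near_coveringP K) cK nat \oo
    (fun m z => (\bigcup_(k < m) rbox (p' k) (q' k)) z)) => z /Kpq[m _ /sub_box zm].
  exists (rbox (p' m) (q' m), [set l | (m < l)%N]) => /=.
    by split => //; exact: nbhs_infty_gt.
  by move=> [y l] /= [ym ml]; exists m.
have {MP} := MP M (leqnn M); move=> KM.
pose v m := rvol (p' m) (q' m).
have sumv : \sum_(m < M) v m <= fine (leb K) + e / 3 + e / 3.
  rewrite -lee_fin -sumEFin.
  apply: (@le_trans _ _ (\sum_(0 <= m <oo)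
      ((rvol (p m) (q m))%:E + (e / 3 / (2 ^ m.+1)%:R)%:E))%E).
    rewrite -(big_mkord xpredT (fun m => (v m)%:E)).
    apply: le_trans (nneseries_lim_ge M _).
      by apply: lee_sum => m _; rewrite -EFinD lee_fin rvol'.
    by move=> m _ _; rewrite -EFinD lee_fin addr_ge0 ?rvol_ge0// divr_ge0// ltW.
  apply: le_trans (@epsilon_trick _ (fun m => (rvol (p m) (q m))%:E) (e / 3) xpredT _ (ltW e30)) _.
    by move=> m; rewrite lee_fin rvol_ge0.
  rewrite !EFinD leeD2r// (le_trans pqe)// leeD2r//.
  by rewrite fineK// ge0_fin_numE ?leb_ge0.
(* Dividing by [M.+1] instead of [M] keeps the quotient positive when [M = 0]. *)
have eM0 : 0 < e / 3 / M.+1%:R by rewrite divr_gt0.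
near=> k.
have cntbox : forall m : 'I_M, rvol a b * cnt k (rbox (p' m) (q' m)) <=
    (v m + e / 3 / M.+1%:R) * N k.
  by near: k; apply: filter_forall => m; exact: near_grid_rbox_count.
have rv0 := rvol_ge0 a b.
apply: (@le_trans _ _ (\sum_(m < M) rvol a b * cnt k (rbox (p' m) (q' m)))).
  rewrite -mulr_sumr ler_wpM2l// -natr_sum ler_nat.
  by apply: leq_trans (grid_count_subset _ _ _ KM) (grid_count_bigcup _ _ _).
apply: le_trans (ler_sum _ (fun m _ => cntbox m)) _.
rewrite -mulr_suml ler_wpM2r// big_split /= sumr_const card_ord.
suff : (e / 3 / M.+1%:R) *+ M <= e / 3.
  by move: sumv; set s := \sum_(m < M) v m; set t := _ *+ M; lra.
rewrite -mulr_natr -mulrA ler_piMr ?(ltW e30)//.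
by rewrite mulrC ler_pdivrMr// mul1r ler_nat.
Unshelve. all: by end_near. Qed.

(* Complementation takes place in a box slightly larger than [rbox a b], since
   the grid points may leave [rbox a b].  Only the easy bound
   [leb (rbox p q) <= rvol p q] is needed. *)
Lemma near_grid_open_count U (e : R) : open U -> U `<=` rbox a b -> 0 < e ->
  \forall k \near \oo, (fine (leb U) - e) * N k <= rvol a b * cnt k U.
Proof.
move=> oU Uab e0.
have e20 : 0 < e / 2 by rewrite divr_gt0.
have [h h0 hP] := prodr_enlarge _ _ (fun j => Num.max 0 (b ord0 j - a ord0 j)) _ e20.
have h20 : 0 < h / 2 by rewrite divr_gt0.
pose B := rbox (\row_j (a ord0 j - h / 2)) (\row_j (b ord0 j + h / 2)).
have UB : U `<=` B.
  by move=> z /Uab zab j; have := zab j; rewrite !mxE; lra.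
have lebB : (leb B <= (rvol a b + e / 2)%:E)%E.
  apply: le_trans (leb_rbox_le _ _) _; rewrite lee_fin.
  apply: le_trans hP; apply: ler_prod => j _; rewrite !mxE.
  by rewrite /Num.max; do 2?[case: ifPn]; rewrite -?leNgt; lra.
have lebBU := leb_diff _ _ (caratheodory_open _ oU) UB.
have fin_le E : E `<=` B -> leb E \is a fin_num.
  move=> EB; rewrite ge0_fin_numE ?leb_ge0//.
  by apply: le_lt_trans (le_leb _ _ EB) (le_lt_trans lebB (ltry _)).
have finU := fin_le _ UB; have finBU := fin_le (B `\` U) (@subDsetl _ _ _).
have cB : compact B := compact_rbox _ _.
have cBU : compact (B `\` U).
  apply: (subclosed_compact _ cB (@subDsetl _ _ _)).
  apply: closedI; last exact: open_closedC.
  by apply: (compact_closed _ cB); exact: norm_hausdorff.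
have [K0 K0P] := x_unif _ h20.
near=> k.
have Kk : (K0 <= k)%N by near: k; exact: nbhs_infty_ge.
have n0 j : (0 < nn k j)%N by move: j; near: k; exact: near_nn_large.
have cntBU : rvol a b * cnt k (B `\` U) <= (fine (leb (B `\` U)) + e / 2) * N k.
  near: k; apply: near_grid_compact_count => //.
  by rewrite -ge0_fin_numE ?leb_ge0.
(* For this [k] every grid point lies in [B], the margin [h / 2] being larger than or equal to its
   deviation. *)
have cntC : grid_count (x k) (~` U) = grid_count (x k) (B `\` U).
  apply: eq_card => i; rewrite !unfold_in /=; apply: asbool_equiv_eq; split=> [Ux|[]//].
  split => // j; rewrite !mxE.
  have := K0P k Kk i j; rewrite ler_norml.
  have L0 : 0 < b ord0 j - a ord0 j by rewrite subr_gt0.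
  have nR : 0 < (nn k j)%:R :> R by rewrite ltr0n.
  have : 0 <= (i j).+1%:R * (b ord0 j - a ord0 j) / (nn k j)%:R <= b ord0 j - a ord0 j.
    rewrite divr_ge0 ?mulr_ge0 ?(ltW L0)//= ler_pdivrMr// mulrC ler_pM2l//.
    by rewrite ler_nat ltn_ord.
  by move: (x k i ord0 j) (_ / _) => u v; lra.
have := grid_countC (x k) U; rewrite cntC => /(congr1 (fun m : nat => m%:R : R)).
rewrite natrD => NE.
have NN0 : 0 <= N k by [].
have : fine (leb U) + fine (leb (B `\` U)) <= rvol a b + e / 2.
  by rewrite -lee_fin EFinD !fineK// -lebBU.
move=> /(ler_wpM2r NN0); move: cntBU; rewrite -NE.
set u := fine _; set v := fine _; set V := rvol _ _; set c1 := _%:R; set c2 := _%:R.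
by nra.
Unshelve. all: by end_near. Qed.

(** The count is squeezed between those of the open set [interior E] and the compact set
    [closure E], which have the same measure. *)
Lemma cvg_grid_density E : E `<=` rbox a b -> leb (closure E `\` interior E) = 0%E ->
  rvol a b * cnt k E / N k @[k --> \oo] --> fine (leb E).
Proof.
move=> Eab bE.
have cab := compact_rbox a b.
have clab : closure E `<=` rbox a b.
  have clab : closed (rbox a b) by apply: (compact_closed _ cab); exact: norm_hausdorff.
  rewrite [X in _ `<=` X]((closure_id _).1 clab).
  exact: closure_subset.
have cclE : compact (closure E).
  by apply: (subclosed_compact _ cab clab); exact: closed_closure.
have fin_le F : F `<=` rbox a b -> leb F \is a fin_num.
  move=> Fab; rewrite ge0_fin_numE ?leb_ge0//.
  by apply: le_lt_trans (le_leb _ _ Fab) (le_lt_trans (leb_rbox_le _ _) (ltry _)).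
have iE := @interior_subset _ E.
have lebcl : leb (closure E) = leb (interior E).
  rewrite (leb_diff _ _ (caratheodory_open _ (@open_interior _ E))).
    by rewrite bE adde0.
  by apply: subset_trans iE _; exact: subset_closure.
have lebE : leb E = leb (interior E).
  apply/eqP; rewrite eq_le (le_leb _ _ iE) andbT -lebcl le_leb//.
  exact: subset_closure.
apply/cvgrPdist_le => e e0; near=> k.
have n0 j : (0 < nn k j)%N by move: j; near: k; exact: near_nn_large.
have NN0 : 0 < N k by rewrite ltr0n prodn_gt0.
have lo : (fine (leb (interior E)) - e) * N k <= rvol a b * cnt k (interior E).
  near: k; apply: near_grid_open_count => //; first exact: open_interior.
  exact: subset_trans iE Eab.
have up : rvol a b * cnt k (closure E) <= (fine (leb (closure E)) + e) * N k.
  near: k; apply: near_grid_compact_count => //.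
  by rewrite -ge0_fin_numE ?leb_ge0 ?fin_le.
have V0 := rvol_ge0 a b.
have cnt_mono F G : F `<=` G -> rvol a b * cnt k F <= rvol a b * cnt k G.
  by move=> FG; rewrite ler_wpM2l// ler_nat; exact: grid_count_subset.
rewrite ler_distlC ler_pdivrMr// ler_pdivlMr// lebE.
rewrite (le_trans lo (cnt_mono _ _ iE)) /= -lebcl.
by apply: le_trans up; apply: cnt_mono; exact: subset_closure.
Unshelve. all: by end_near. Qed.

End GridDensity.

(** * Level sets of [f] and their distribution function *)

(** Continuity from below of the measure that [mu] induces on its Carathéodory sets. *)
Lemma cvg_caratheodory_bigcup (R : realType) (T : pointedType)
    (mu : {outer_measure set T -> \bar R}) (F : nat -> set T) :
  (forall n, mu.-caratheodory (F n)) -> {homo F : n m / (n <= m)%N >-> (n <= m)%O} ->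
  mu (F n) @[n --> \oo] --> mu (\bigcup_n F n).
Proof.
move=> mF ndF; have := @nondecreasing_cvg_mu _ (caratheodory_type mu) R mu F mF.
by apply => //; exact: caratheodory_measurable_bigcup.
Qed.

Lemma cvg_caratheodory_bigcap (R : realType) (T : pointedType)
    (mu : {outer_measure set T -> \bar R}) (F : nat -> set T) :
  (mu (F 0%N) < +oo)%E ->
  (forall n, mu.-caratheodory (F n)) -> {homo F : n m / (n <= m)%N >-> (m <= n)%O} ->
  mu (F n) @[n --> \oo] --> mu (\bigcap_n F n).
Proof.
move=> F0 mF niF; have := @nonincreasing_cvg_mu _ (caratheodory_type mu) R mu F F0 mF.
by apply => //; exact: (@bigcapT_measurable _ (caratheodory_type mu)).
Qed.

Definition level {R : realType} {d : nat} (O : set 'rV[R]_d) (f : 'rV[R]_d -> R)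
  (P : set R) : set 'rV[R]_d := [set x | O x /\ P (f x)].

Section Levels.
Context {R : realType} {d : nat} (O : set 'rV[R]_d.+1) (f : 'rV[R]_d.+1 -> R).
Local Notation leb := (@leb R d.+1).
Local Notation lev := (level O f).
Implicit Types P Q : set R.
Hypothesis bdO : leb (closure O `\` interior O) = 0%E.
Hypothesis fcont : cont_ae O f.

Lemma level_subset P Q : P `<=` Q -> lev P `<=` lev Q.
Proof. by move=> PQ x [Ox /PQ]. Qed.

Lemma level_setT : lev setT = O.
Proof. by apply/seteqP; split=> [x []|x]. Qed.

Lemma interior_level P x : interior O x -> cont_at_in O f x ->
  nbhs (f x) P -> interior (lev P) x.
Proof.
move=> iO fx /fx; rewrite /nbhs /= => wP.
by apply: filterS2 iO wP => y Oy Py; split => //; exact: Py.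
Qed.

(** The exceptional set: a point of [closure O] outside it is interior to [O] and a continuity point
    of [f]. *)
Let bad := (closure O `\` interior O) `|` [set x | O x /\ ~ cont_at_in O f x].

Let bad0 : leb bad = 0%E.
Proof. exact: leb_nullU. Qed.

(** Measurability of [f] comes from continuity almost everywhere: [lev P] is its interior together
    with a part of [bad]. *)
Lemma caratheodory_level_open P : open P -> leb.-caratheodory (lev P).
Proof.
move=> oP; rewrite -(setDUK (@interior_subset _ (lev P))).
apply: caratheodory_measurable_setU.
  by apply: caratheodory_open; exact: open_interior.
apply: caratheodory_null; apply: leb_null_sub bad0 => x [[Ox Px] nix].
have [iO|niO] := pselect (interior O x).
  right; split => // fx; apply: nix; apply: interior_level => //.
  exact: open_nbhs_nbhs.
by left; split => //; exact: subset_closure.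
Qed.

Lemma caratheodory_domain : leb.-caratheodory O.
Proof. by rewrite -level_setT; apply: caratheodory_level_open; exact: openT. Qed.

Lemma caratheodory_level_closed P : closed P -> leb.-caratheodory (lev P).
Proof.
move=> cP; have -> : lev P = O `\` lev (~` P).
  apply/seteqP; split=> [x [Ox Px]|x [Ox nPx]]; first by split => // -[].
  by split => //; apply: contrapT => ?; exact: nPx.
apply: caratheodory_measurable_setD; first exact: caratheodory_domain.
by apply: caratheodory_level_open; rewrite openC.
Qed.

(** At a boundary point outside [bad], [f x < u] would make the point interior, and [f x > u] would
    give it a neighbourhood disjoint from the level set. Hence [f x = u]. *)
Lemma level_boundary (u : R) : leb (lev [set u]) = 0%E ->
  leb (closure (lev [set v | v <= u]) `\` interior (lev [set v | v <= u])) = 0%E.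
Proof.
move=> u0; apply: leb_null_sub (leb_nullU _ _ bad0 u0) => x [clx nix].
have clOx : closure O x by apply: closure_subset clx => y [].
have [iO|niO] := pselect (interior O x); last by left; left.
have Ox : O x := interior_subset iO.
have [fx|nfx] := pselect (cont_at_in O f x); last by left; right.
right; split => //=; case: (ltgtP (f x) u) => // fxu; exfalso.
- apply: nix; apply: interior_level => //.
  by apply: filterS (lt_nbhsl fxu) => v; exact: ltW.
- have := interior_level _ _ iO fx (lt_nbhsr fxu).
  by move=> /clx[y [[_ /= yu] [_ /=]]]; rewrite ltNge yu.
Qed.

Hypothesis Ofin : (leb O < +oo)%E.

Lemma level_fin P : leb (lev P) \is a fin_num.
Proof.
rewrite ge0_fin_numE ?leb_ge0//; apply: le_lt_trans Ofin.
by apply: le_leb => x [].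
Qed.

(** The image under [f] of [leb] on [O], with real values. *)
Definition mlev P : R := fine (leb (lev P)).

Lemma mlev_ge0 P : 0 <= mlev P.
Proof. by rewrite fine_ge0// leb_ge0. Qed.

Lemma mlevK P : (mlev P)%:E = leb (lev P).
Proof. by rewrite fineK// level_fin. Qed.

Lemma le_mlev P Q : P `<=` Q -> mlev P <= mlev Q.
Proof. by move=> PQ; rewrite -lee_fin !mlevK le_leb//; exact: level_subset. Qed.

Lemma mlev_split P Q : leb.-caratheodory (lev P) ->
  mlev Q = mlev (Q `&` P) + mlev (Q `&` ~` P).
Proof.
move=> mP; apply: EFin_inj; rewrite EFinD !mlevK (mP (lev Q)).
congr (leb _ + leb _)%E; apply/seteqP; split => x.
- by move=> [[? ?] [? ?]].
- by move=> [? [? ?]].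
- by move=> [[Ox Qx] nPx]; split => //; split => // Px; apply: nPx.
- by move=> [Ox [Qx nPx]]; split => // -[].
Qed.

Lemma mlev_disjoint P Q : leb.-caratheodory (lev P) -> P `&` Q = set0 ->
  mlev (P `|` Q) = mlev P + mlev Q.
Proof.
move=> mP PQ; rewrite (mlev_split _ _ mP); congr (mlev _ + mlev _).
  by rewrite setUK.
rewrite setIUl setICr set0U; apply/seteqP; split=> [v []//|v Qv].
by split => // Pv; rewrite -[False]/(set0 v) -PQ.
Qed.

(** Infinitely many disjoint level sets of mass above [e] would exceed the finite mass of [O]. *)
Lemma finite_atoms (e : R) : 0 < e -> finite_set [set u | e < mlev [set u]].
Proof.
move=> e0; apply: contrapT => /infiniteP/pcard_leP/injfunPex[/= q qe q_inj].
have lower m : m%:R * e <= mlev [set q k | k in `I_m].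
  elim: m => [|m IH]; first by rewrite mul0r mlev_ge0.
  have -> : [set q k | k in `I_m.+1] = [set q m] `|` [set q k | k in `I_m].
    apply/seteqP; split=> [_ [k /= km <-]|v [->|[k /= km <-]]].
    - move: km; rewrite ltnS leq_eqVlt => /predU1P[->|km]; first by left.
      by right; exists k.
    - by exists m => /=.
    - by exists k => //=; exact: ltnW.
  rewrite mlev_disjoint; last 2 first.
  - by apply: caratheodory_level_closed; exact: closed_eq.
  - rewrite -subset0 => v [-> [k /= km]] /q_inj.
    by rewrite !inE => /(_ I I) kE; rewrite kE ltnn in km.
  by rewrite -natr1 mulrDl mul1r addrC lerD// ltW// qe.
have := lower (Num.truncn (mlev setT / e)).+1.
move=> /le_trans/(_ (le_mlev _ setT (@subsetT _ _))).
by rewrite -ler_pdivlMr// leNgt truncnS_gt.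
Qed.

(** The atoms form a countable set, whereas an interval consisting of atoms would have positive
    Lebesgue measure. *)
Lemma nonatom_dense (u v : R) : u < v -> exists2 w, u < w < v & leb (lev [set w]) = 0%E.
Proof.
move=> uv; apply: contrapT => no.
have cnt : countable (\bigcup_n [set w | n.+1%:R^-1 < mlev [set w]]).
  by apply: bigcup_countable => // n _; apply/finite_set_countable/finite_atoms; rewrite invr_gt0.
have /sub_countable/(_ cnt) : ([set` `]u, v[] #<=
    \bigcup_n [set w | n.+1%:R^-1 < mlev [set w]])%card.
  apply: subset_card_le => w /=; rewrite in_itv /= => uwv.
  have : 0 < mlev [set w].
    rewrite lt_neqAle mlev_ge0 andbT; apply/eqP => w0; apply: no; exists w => //.
    by rewrite -mlevK -w0.
  by move=> /ltr_add_invr[k]; rewrite add0r => kw; exists k.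
move=> /countable_lebesgue_measure0; rewrite lebesgue_measure_itv /= lte_fin uv.
by move/eqP; rewrite -EFinB eqe subr_eq0 gt_eqF.
Qed.

Lemma ER_gt0 (z : R) P : ER O f z -> nbhs z P -> 0 < mlev P.
Proof.
move=> ERz /nbhs_ballP[e /= e0 eP]; rewrite -lte_fin mlevK.
apply: lt_le_trans (ERz _ e0) _; apply: le_leb => x [Ox fxz]; split => //.
by apply: eP; rewrite /ball /= distrC.
Qed.

(** [ER O f] is the support of the image measure. Its complement is covered by the countably many
    rational intervals of zero mass. *)
Lemma leb_notin_ER : leb (lev (~` ER O f)) = 0%E.
Proof.
pose I (t : rat * rat) : set R := [set` `]ratr t.1, ratr t.2[ ].
apply: (@leb_null_sub _ _ _ (\bigcup_t (if `[< leb (lev (I t)) = 0%E >] then lev (I t) else set0))).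
  move=> x [Ox /existsNP[e /not_implyP[e0 /negP]]]; rewrite -leNgt => le0.
  have [r] := @rat_in_itvoo _ (f x - e) (f x) ltac:(by rewrite ltrBlDr ltrDl).
  have [s] := @rat_in_itvoo _ (f x) (f x + e) ltac:(by rewrite ltrDl).
  rewrite !in_itv /= => /andP[s1 s2] /andP[r1 r2].
  exists (r, s) => //; rewrite asboolT /=.
    by split => //; rewrite /I /= in_itv /= r2 s1.
  have -> : leb (lev (I (r, s))) = 0%E; last by [].
  apply/eqP; rewrite eq_le leb_ge0 andbT; apply: le_trans le0; apply: le_leb.
  move=> y [Oy]; rewrite /I /= in_itv /= => /andP[y1 y2]; split => //=.
  by rewrite ltr_norml; apply/andP; split; lra.
by apply: leb_null_bigcup => t; case: asboolP => // _; exact: leb0.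
Qed.

Lemma ER_ex P : 0 < mlev P -> exists2 z, ER O f z & P z.
Proof.
move=> P0; apply: contrapT => no; move: P0; rewrite lt_neqAle => /andP[/negP + _]; apply.
rewrite eq_sym; apply/eqP; rewrite /mlev (leb_null_sub _ (lev (~` ER O f)))//.
  by apply: level_subset => z Pz ERz; apply: no; exists z.
exact: leb_notin_ER.
Qed.

(** The normalised distribution function of [f], spelled as in [fdag], so that [fdag] is its
    quantile function by conversion. *)
Definition rcdf (u : R) : R :=
  fine (leb [set x | O x /\ f x <= u]) / fine (leb O).

Hypothesis O0 : (0 < leb O)%E.

Let mO0 : 0 < fine (leb O).
Proof. by rewrite fine_gt0// O0 Ofin. Qed.

Lemma le_rcdf u v : u <= v -> rcdf u <= rcdf v.
Proof.
move=> uv; rewrite ler_pM2r ?invr_gt0//; apply: (le_mlev [set t | t <= u] [set t | t <= v]).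
by move=> t /= /le_trans; apply.
Qed.

Lemma caratheodory_le (u : R) : leb.-caratheodory (lev [set t | t <= u]).
Proof. by apply: caratheodory_level_closed; exact: closed_le. Qed.

(** Continuity from below along the integers: the sets [F n] exhaust [O]. *)
Lemma rcdf_gt_ex (y : R) : y < 1 -> exists u, y < rcdf u.
Proof.
move=> y1; pose F (n : nat) : set 'rV[R]_d.+1 := lev [set t | t <= n%:R].
have UF : \bigcup_n F n = O.
  apply/seteqP; split=> [x [n _ []//]|x Ox]; exists (Num.truncn (f x)).+1 => //.
  by split => //=; exact/ltW/truncnS_gt.
have : leb (F n) @[n --> \oo] --> leb O.
  rewrite -UF; apply: (cvg_caratheodory_bigcup _ _ leb F) => [n|n m nm].
  - exact: caratheodory_le.
  - apply/subsetPset; apply: level_subset => t /= /le_trans; apply.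
    by rewrite ler_nat.
rewrite -[leb O](fineK _); last by rewrite ge0_fin_numE ?leb_ge0.
move=> /fine_cvgP[_] /cvgr_gt/(_ (y * fine (leb O))) []; first by rewrite gtr_pMl.
move=> n _ /(_ n (leqnn n)) /= yn; exists n%:R.
by rewrite /rcdf ltr_pdivlMr.
Qed.

Lemma rcdf_lt_ex (y : R) : 0 < y -> exists u, rcdf u < y.
Proof.
move=> y0; pose F (n : nat) : set 'rV[R]_d.+1 := lev [set t | t <= - n%:R].
have IF : \bigcap_n F n = set0.
  rewrite -subset0 => x /(_ (Num.truncn (- f x)).+1 I)[_ /=].
  by rewrite lerNr leNgt truncnS_gt.
have : leb (F n) @[n --> \oo] --> leb (set0 : set 'rV[R]_d.+1).
  rewrite -IF; apply: (cvg_caratheodory_bigcap _ _ leb F) => [|n|n m nm].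
  - by rewrite -ge0_fin_numE ?leb_ge0//; exact: level_fin.
  - exact: caratheodory_le.
  - apply/subsetPset; apply: level_subset => t /= /le_trans; apply.
    by rewrite lerN2 ler_nat.
rewrite leb0 => /fine_cvgP[_] /cvgr_lt/(_ (y * fine (leb O))) []; first by rewrite mulr_gt0.
move=> n _ /(_ n (leqnn n)) /= yn; exists (- n%:R).
by rewrite /rcdf ltr_pdivrMr.
Qed.

Lemma rcdf_gt0 (z u : R) : ER O f z -> z < u -> 0 < rcdf u.
Proof.
move=> ERz zu; rewrite divr_gt0//; apply: (ER_gt0 z [set t | t <= u]) => //.
by apply: filterS (lt_nbhsl zu) => v; exact: ltW.
Qed.

Lemma rcdfC (u : R) : rcdf u + mlev [set t | u < t] / fine (leb O) = 1.
Proof.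
have -> : rcdf u = mlev [set t | t <= u] / fine (leb O) by [].
rewrite -mulrDl -mlev_disjoint; first last.
- by rewrite -subset0 => t [/= tu]; rewrite ltNge tu.
- exact: caratheodory_le.
rewrite (_ : _ `|` _ = setT) /mlev ?level_setT ?divff ?gt_eqF//.
by apply/seteqP; split => // t _ /=; case: (leP t u) => ?; [left|right].
Qed.

Lemma rcdf_le1 (u : R) : rcdf u <= 1.
Proof. by rewrite -(rcdfC u) lerDl divr_ge0 ?mlev_ge0// ltW. Qed.

Lemma rcdf_lt1 (z u : R) : ER O f z -> u < z -> rcdf u < 1.
Proof.
move=> ERz uz; rewrite -(rcdfC u) ltrDl divr_gt0//.
by apply: ER_gt0 ERz _; exact: lt_nbhsr.
Qed.

(* An interval on which the rcdf is constant contains no point of [ER O f]; by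
   connectedness the mass then lies on one side of it. *)
Lemma rcdf_lt (u v : R) : connected (ER O f) -> u < v -> 0 < rcdf u -> rcdf v < 1 ->
  rcdf u < rcdf v.
Proof.
move=> /connected_intervalP itvER uv u0 v1.
have [|z1 ERz1 /= z1u] := ER_ex [set t | t <= u].
  by move: u0; rewrite /rcdf pmulr_lgt0// invr_gt0.
have [|z2 ERz2 /= z2v] := ER_ex [set t | v < t].
  have L0 : 0 < (fine (leb O))^-1 by rewrite invr_gt0.
  rewrite -(pmulr_lgt0 _ L0); move: (rcdfC v) v1.
  by set r := mlev _ / _; lra.
(* The midpoint lies between the points [z1 <= u] and [z2 > v] of the interval [ER O f]. *)
have ERw : ER O f ((u + v) / 2).
  by apply: (itvER z1 z2) => //; apply/andP; split; lra.
have nw : nbhs ((u + v) / 2) [set t | t <= v /\ ~ t <= u].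
  have [uw wv] : u < (u + v) / 2 /\ (u + v) / 2 < v by split; lra.
  apply: filterS2 (lt_nbhsl wv) (lt_nbhsr uw) => t tv ut.
  by split; [exact: ltW|apply/negP; rewrite -ltNge].
have := ER_gt0 _ _ ERw nw.
have := mlev_split [set t | t <= u] [set t | t <= v] (caratheodory_le u).
rewrite (_ : [set t | t <= v] `&` [set t | t <= u] = [set t | t <= u]); last first.
  by apply/seteqP; split => t /=; [case|move=> tu; split => //; apply: le_trans tu (ltW uv)].
move=> mv w0; rewrite /rcdf ltr_pM2r ?invr_gt0//.
by rewrite -[ltRHS]/(mlev [set t | t <= v]) mv ltrDl.
Qed.

End Levels.

(** * Splines and the monotone rearrangement *)

(** In the lower bound on [m], one unit pays for truncation and another for replacing [(size s).-1]
    by [size s]. *)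
Lemma lin_spline_between (R : realType) (s : seq R) (y : R) :
  sorted <=%R s -> (1 < size s)%N -> 0 <= y <= 1 ->
  exists m : nat, [/\ (m.+1 < size s)%N, s`_m <= lin_spline s y <= s`_m.+1 &
    y * (size s)%:R - 2 <= m%:R <= y * (size s)%:R].
Proof.
move=> ss s1 /andP[y0 y1].
have sizeE : (size s)%:R = (size s).-1%:R + 1 :> R.
  by rewrite natr1 prednK// (ltn_trans _ s1).
pose w := (size s).-1; pose t := y * w%:R.
have w0 : (0 < w)%N by rewrite /w; lia.
have wR : 1 <= w%:R :> R by rewrite ler1n.
have t0 : 0 <= t by rewrite mulr_ge0.
have tw : t <= w%:R by rewrite ler_piMl.
(* The cap [w.-1] acts only when [t = w], that is at [y = 1], where the last cell is used at its
   right end. *)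
pose m := minn (Num.truncn t) w.-1.
have mw : (m < w)%N by rewrite /m; lia.
have [tm tm1 mt] : [/\ m%:R <= t, t - m%:R <= 1 & t - 1 <= m%:R].
  have /andP[t1 t2] := truncn_itv t0.
  have [tw1|wt] := leqP (Num.truncn t) w.-1.
    by move: t2; rewrite /m (minn_idPl tw1) -natr1; split; lra.
  have {}wt : (w <= Num.truncn t)%N by lia.
  have mE : m%:R = w%:R - 1 :> R.
    by rewrite /m (minn_idPr _) ?leq_pred_trans// -?subn1 ?natrB//; lia.
  have : w%:R <= t by apply: le_trans t1; rewrite ler_nat.
  by rewrite mE; split; lra.
have msize : (m.+1 < size s)%N by move: mw; rewrite /w; lia.
exists m; split=> //.
  have smm : s`_m <= s`_m.+1 by apply: (sortedP 0 ss).
  have -> : lin_spline s y = s`_m + (t - m%:R) * (s`_m.+1 - s`_m) by [].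
  by nra.
by move: tm mt; rewrite sizeE /t -/w; nra.
Qed.

(** In a sorted list the entries [<= u] come first, so any entry whose index is at least their
    number exceeds [u]. *)
Lemma lin_spline_ge (R : realType) (s : seq R) (y u : R) :
  sorted <=%R s -> (1 < size s)%N -> 0 <= y <= 1 ->
  (count (<= u) s)%:R <= y * (size s)%:R - 2 -> u <= lin_spline s y.
Proof.
move=> ss s1 y01; have [m [ms /andP[sm _] /andP[ym _]]] := lin_spline_between _ _ _ ss s1 y01.
move=> /le_trans/(_ ym); rewrite ler_nat => cm; apply: le_trans sm.
by apply: ltW; apply: nth_count_gt => //; rewrite cm ltnW.
Qed.

Lemma lin_spline_le (R : realType) (s : seq R) (y v : R) :
  sorted <=%R s -> (1 < size s)%N -> 0 <= y <= 1 ->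
  y * (size s)%:R + 1 < (count (<= v) s)%:R -> lin_spline s y <= v.
Proof.
move=> ss s1 y01; have [m [_ /andP[_ sm] /andP[_ my]]] := lin_spline_between _ _ _ ss s1 y01.
move=> yc; apply: le_trans sm _; apply: nth_count_le => //.
by rewrite -(ltr_nat R) -natr1; apply: le_lt_trans yc; rewrite lerD2r.
Qed.

Lemma lin_spline_bounds (R : realType) (s : seq R) (y : R) (P : interval R) :
  sorted <=%R s -> (1 < size s)%N -> 0 <= y <= 1 ->
  {in s, forall z, z \in P} -> lin_spline s y \in P.
Proof.
move=> ss s1 y01 sP; have [m [ms /andP[sm Sm] _]] := lin_spline_between _ _ _ ss s1 y01.
apply: (@interval_is_interval _ P s`_m s`_m.+1); last by rewrite sm Sm.
  by apply: sP; rewrite mem_nth// ltnW.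
by apply: sP; rewrite mem_nth.
Qed.

Section Samples.
Context {R : realType} {d : nat} {n : 'I_d -> nat} (O : set 'rV[R]_d)
  (f : 'rV[R]_d -> R) (x : multi_idx d n -> 'rV[R]_d).

Lemma sorted_sorted_samples : sorted <=%R (sorted_samples O f x).
Proof. exact/sort_sorted/le_total. Qed.

Lemma count_sorted_samples (P : pred R) :
  count P (sorted_samples O f x) = grid_count x [set z | O z /\ P (f z)].
Proof.
rewrite count_sort count_map count_filter -sum1_count big_enum_cond sum1_card.
apply: eq_card => i; rewrite !unfold_in /= asboolT //=.
by apply/andP/asboolP => [[Px /asboolP Ox]|[Ox Px]]; split=> //; exact/asboolP.
Qed.

Lemma size_sorted_samples : size (sorted_samples O f x) = grid_count x O.
Proof.
rewrite -count_predT count_sorted_samples; congr grid_count.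
by apply/seteqP; split=> [z []|z].
Qed.

Lemma sorted_samplesP (z : R) : z \in sorted_samples O f x ->
  exists2 p, O p & z = f p.
Proof.
rewrite mem_sort => /mapP[i]; rewrite mem_filter => /andP[/asboolP Oi _] ->.
by exists (x i).
Qed.

End Samples.

Section Rearrangement.
Context {R : realType} {d : nat} (O : set 'rV[R]_d.+1) (f : 'rV[R]_d.+1 -> R).
Local Notation leb := (@leb R d.+1).
Local Notation F := (rcdf O f).
Hypothesis bdO : leb (closure O `\` interior O) = 0%E.
Hypothesis fcont : cont_ae O f.
Hypothesis Ofin : (leb O < +oo)%E.
Hypothesis O0 : (0 < leb O)%E.

Let F_mono u v : u <= v -> F u <= F v.
Proof. exact: le_rcdf. Qed.

Lemma fdagE (y : R) : 0 < y < 1 -> fdag O f y = inf [set u | y <= F u].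
Proof. by move=> /andP[y0 y1]; rewrite /fdag gt_eqF// lt_eqF. Qed.

(** The limits of [F] at both infinities ensure that the [inf] in [fdag] is a genuine infimum. *)
Let fdag_has_inf (y : R) : 0 < y < 1 -> has_inf [set u | y <= F u].
Proof.
move=> /andP[y0 y1]; split.
  by have [u /ltW yu] := rcdf_gt_ex O f bdO fcont Ofin O0 y y1; exists u.
have [l ly] := rcdf_lt_ex O f bdO fcont Ofin O0 y y0; exists l => u /= yu.
by apply/ltW; rewrite ltNge; apply/negP => /F_mono; move: yu ly; lra.
Qed.

Lemma fdag_le (y v : R) : 0 < y < 1 -> y <= F v -> fdag O f y <= v.
Proof.
by move=> y01 yv; rewrite fdagE//; apply: inf_lbound => //; exact: (fdag_has_inf _ y01).2.
Qed.

Lemma fdag_ge (y u : R) : 0 < y < 1 -> (forall v, v < u -> F v < y) -> u <= fdag O f y.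
Proof.
move=> y01 uy; rewrite fdagE//; apply: lb_le_inf; first exact: (fdag_has_inf _ y01).1.
by move=> v /=; rewrite !leNgt; apply: contra => /uy.
Qed.

Lemma fdag_ge_rcdf (y u : R) : 0 < y < 1 -> F u < y -> u <= fdag O f y.
Proof. by move=> y01 uy; apply: fdag_ge => // v /ltW/F_mono vu; exact: le_lt_trans uy. Qed.

Lemma rcdf_straddle (y e : R) : connected (ER O f) -> 0 < y < 1 -> 0 < e ->
  exists u v, [/\ F u < y < F v, v - u <= e,
    leb (level O f [set u]) = 0%E & leb (level O f [set v]) = 0%E].
Proof.
move=> cER y01 e0; set q := fdag O f y.
have [u /andP[u1 u2] u0] := nonatom_dense O f bdO fcont Ofin (q - e / 2) q ltac:(lra).
have [v /andP[v1 v2] v0] := nonatom_dense O f bdO fcont Ofin q (q + e / 2) ltac:(lra).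
exists u, v; split => //; last lra.
apply/andP; split.
  by rewrite ltNge; apply/negP => /(fdag_le _ _ y01); rewrite leNgt u2.
(* Otherwise [F] would be constantly [y] from the midpoint of [q] and [v] up to [v], against
   [rcdf_lt]. *)
rewrite ltNge; apply/negP => vy.
have qv : q < (q + v) / 2 by lra.
have wv : (q + v) / 2 < v by lra.
have yw : y <= F ((q + v) / 2).
  by rewrite leNgt; apply/negP => /(fdag_ge_rcdf _ _ y01); rewrite leNgt qv.
case/andP: y01 => y0 y1.
have := rcdf_lt O f bdO fcont Ofin O0 _ _ cER wv (lt_le_trans y0 yw) (le_lt_trans vy y1).
by rewrite ltNge (le_trans vy yw).
Qed.

End Rearrangement.

(** * Locally uniform convergence of the splines *)

Section Convergence.
Context {R : realType} {d : nat} (O : set 'rV[R]_d.+1) (f : 'rV[R]_d.+1 -> R)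
  (a b : 'rV[R]_d.+1) (nn : nat -> 'I_d.+1 -> nat)
  (x : forall k : nat, multi_idx d.+1 (nn k) -> 'rV[R]_d.+1).
Local Notation leb := (@leb R d.+1).
Local Notation F := (rcdf O f).
Local Notation lev := (level O f).
Hypothesis bdO : leb (closure O `\` interior O) = 0%E.
Hypothesis O0 : (0 < leb O)%E.
Hypothesis fcont : cont_ae O f.
Hypothesis cER : connected (ER O f).
Hypothesis Oab : O `<=` rbox a b.
Hypothesis nn_oo : forall (j : 'I_d.+1) (M : nat),
  exists K : nat, forall k : nat, (K <= k)%N -> (M <= nn k j)%N.
Hypothesis x_unif : forall e : R, 0 < e -> exists K : nat, forall k : nat,
  (K <= k)%N -> forall (i : multi_idx d.+1 (nn k)) (j : 'I_d.+1),
    `|x k i ord0 j - (a ord0 j + (i j).+1%:R * (b ord0 j - a ord0 j)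
                                    / (nn k j)%:R)| <= e.

Local Notation cnt k E := ((grid_count (x k) E)%:R : R).
Local Notation N k := ((\prod_j nn k j)%N%:R : R).
Local Notation s k := (sorted_samples O f (x k)).

Let Ofin : (leb O < +oo)%E.
Proof. exact: le_lt_trans (le_leb _ _ Oab) (le_lt_trans (leb_rbox_le _ _) (ltry _)). Qed.

Let mO0 : 0 < fine (leb O).
Proof. by rewrite fine_gt0// O0 Ofin. Qed.

Let vol0 : 0 < rvol a b.
Proof.
by rewrite -lte_fin; apply: lt_le_trans O0 (le_trans (le_leb _ _ Oab) (leb_rbox_le _ _)).
Qed.

(** The box contains a set of positive measure, so none of its sides degenerates. *)
Let ab j : a ord0 j < b ord0 j.
Proof.
rewrite ltNge; apply/negP => ba; move: vol0.
by rewrite /rvol (bigD1 j)//= max_l ?mul0r ?ltxx// subr_le0.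
Qed.

Let density E := cvg_grid_density a b nn x ab nn_oo x_unif E.

Lemma near_grid_pos : \forall k \near \oo, 0 < N k.
Proof.
near=> k; rewrite ltr0n prodn_gt0// => j.
by move: j; near: k; exact: near_nn_large.
Unshelve. all: by end_near. Qed.

Lemma near_size_large (C : R) : \forall k \near \oo, C <= (size (s k))%:R.
Proof.
(* Eventually the density of the grid in [O] exceeds half its limit, so a grid of at least [M]
   points has at least [C] of them in [O]. *)
pose M := (Num.truncn (`|C| * (2 * rvol a b / fine (leb O)))).+1.
near=> k.
have Nk : 0 < N k by near: k; exact: near_grid_pos.
have nM j : (M <= nn k j)%N by move: j; near: k; exact: near_nn_large.
have MN : M%:R <= N k.
  rewrite ler_nat (bigD1 ord0)//= -[leqLHS]muln1 leq_mul// prodn_gt0// => j.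
  by apply: leq_trans (nM j).
have dens : fine (leb O) / 2 < rvol a b * cnt k O / N k.
  near: k; apply: (cvgr_gt _ (density _ Oab bdO)).
  by rewrite ltr_pdivrMr// mulr_natr mulr2n ltrDl.
rewrite size_sorted_samples (le_trans (ler_norm C))//.
have : `|C| * (2 * rvol a b / fine (leb O)) <= N k.
  by apply: le_trans MN; exact/ltW/truncnS_gt.
rewrite mulrA ler_pdivrMr//; move: dens; rewrite ltr_pdivlMr//.
set m := fine _; set V := rvol _ _; set c := cnt _ _ => dens CN.
have V0 : 0 < V := vol0.
rewrite -(ler_pM2l V0); lra.
Unshelve. all: by end_near. Qed.

Lemma cvg_sample_rcdf (u : R) : leb (lev [set u]) = 0%E ->
  (count (<= u) (s k))%:R / (size (s k))%:R @[k --> \oo] --> F u.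
Proof.
move=> u0.
have lab : lev [set v | v <= u] `<=` rbox a b by move=> z [/Oab].
have lim : (rvol a b * cnt k (lev [set v | v <= u]) / N k) * (rvol a b * cnt k O / N k)^-1
    @[k --> \oo] --> F u.
  apply: cvgM; first exact: density _ lab (level_boundary O f bdO fcont u u0).
  by apply: cvgV; [exact: lt0r_neq0|exact: density _ Oab bdO].
apply: cvg_trans lim; apply: near_eq_cvg; near=> k.
have Nk : 0 < N k by near: k; exact: near_grid_pos.
rewrite count_sorted_samples size_sorted_samples /=.
(* Without samples both quotients are 0, since the inverse of 0 is 0. *)
have [->|c0] := eqVneq (cnt k O) 0; first by rewrite !(mulr0,mul0r,invr0).
by field; rewrite c0 !gt_eqF.
Unshelve. all: by end_near. Qed.

Local Notation fn := (fun k y => lin_spline (s k) y).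

(** Half of the margin [c] covers the error of the empirical distribution function, the other half
    the index shift in [lin_spline_ge]. The threshold on [k] is independent of [y]. *)
Lemma near_spline_ge (u c : R) : leb (lev [set u]) = 0%E -> 0 < c ->
  \forall k \near \oo, forall y, 0 <= y <= 1 -> F u + c <= y -> u <= fn k y.
Proof.
move=> u0 c0; have c20 : 0 < c / 2 by rewrite divr_gt0.
near=> k => y y01 uy.
have S : 2 / (c / 2) + 2 <= (size (s k))%:R by near: k; exact: near_size_large.
have Fk : (count (<= u) (s k))%:R / (size (s k))%:R < F u + c / 2.
  by near: k; apply: (cvgr_lt _ (cvg_sample_rcdf _ u0)); rewrite ltrDl.
have p0 : 0 < 2 / (c / 2) by rewrite divr_gt0.
have S0 : 0 < (size (s k))%:R :> R by lra.
have S1 : (1 < size (s k))%N by rewrite -(ltr_nat R); lra.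
apply: lin_spline_ge => //; first exact: sorted_sorted_samples.
move: Fk; rewrite ltr_pdivrMr// => /ltW/le_trans; apply.
have : 2 <= (c / 2) * (size (s k))%:R by rewrite mulrC -ler_pdivrMr//; lra.
by move: S0 uy; set S' := (size _)%:R; set Fu := F u; nra.
Unshelve. all: by end_near. Qed.

Lemma near_spline_le (v c : R) : leb (lev [set v]) = 0%E -> 0 < c ->
  \forall k \near \oo, forall y, 0 <= y <= 1 -> y + c <= F v -> fn k y <= v.
Proof.
move=> v0 c0; have c20 : 0 < c / 2 by rewrite divr_gt0.
near=> k => y y01 vy.
have S : 1 / (c / 2) + 2 <= (size (s k))%:R by near: k; exact: near_size_large.
have Fk : F v - c / 2 < (count (<= v) (s k))%:R / (size (s k))%:R.
  by near: k; apply: (cvgr_gt _ (cvg_sample_rcdf _ v0)); rewrite ltrBlDr ltrDl.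
have p0 : 0 < 1 / (c / 2) by rewrite divr_gt0.
have S0 : 0 < (size (s k))%:R :> R by lra.
have S1 : (1 < size (s k))%N by rewrite -(ltr_nat R); lra.
apply: lin_spline_le => //; first exact: sorted_sorted_samples.
move: Fk; rewrite ltr_pdivlMr//; apply: le_lt_trans.
have : 1 <= (c / 2) * (size (s k))%:R by rewrite mulrC -ler_pdivrMr//; lra.
by move: S0 vy; set S' := (size _)%:R; set Fv := F v; nra.
Unshelve. all: by end_near. Qed.

Let fdag_le' := fdag_le O f bdO fcont Ofin O0.
Let fdag_ge' := fdag_ge O f bdO fcont Ofin O0.
Let fdag_ge_rcdf' := fdag_ge_rcdf O f bdO fcont Ofin O0.
Let F_le1 := rcdf_le1 O f bdO fcont Ofin O0.

Let F_ge0 u : 0 <= F u.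
Proof. by rewrite divr_ge0 ?fine_ge0 ?leb_ge0. Qed.

(** The joint filter in [y'] and [k] is the one of the near-covering form of compactness. The guard
    [0 <= y' <= 1] is there because neighbourhoods of 0 and 1 leave the unit interval. *)
Definition locally_uniform_cvg (y : R) := forall e : R, 0 < e ->
  \forall y' \near y & k \near \oo, 0 <= y' <= 1 -> `|fn k y' - fdag O f y'| <= e.

Lemma locally_uniform_cvg_oo (y : R) : 0 < y < 1 -> locally_uniform_cvg y.
Proof.
move=> y01 e e0.
have [u [v [/andP[uy yv] vu u0 v0]]] := rcdf_straddle O f bdO fcont Ofin O0 y e cER y01 e0.
(* Half the smaller gap: a point within [c] of [y] keeps a margin [c] from both [F u] and [F v]. *)
pose c := Num.min (y - F u) (F v - y) / 2.
have c0 : 0 < c by rewrite divr_gt0// lt_min !subr_gt0 uy yv.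
have [cu cv] : c <= (y - F u) / 2 /\ c <= (F v - y) / 2.
  by split; rewrite ler_pM2r ?invr_gt0// ge_min lexx ?orbT.
exists (ball y c, [set k | (forall y, 0 <= y <= 1 -> F u + c <= y -> u <= fn k y) /\
                           (forall y, 0 <= y <= 1 -> y + c <= F v -> fn k y <= v)]) => /=.
  split; first exact: nbhsx_ballx.
  by apply: filterI; [exact: near_spline_ge|exact: near_spline_le].
move=> [y' k] /= [yy' [geu lev]] y'01.
move: yy'; rewrite /ball /= ltr_distlC => /andP[y'1 y'2].
have uy' : F u + c <= y' by lra.
have vy' : y' + c <= F v by lra.
have y'oo : 0 < y' < 1 by have := F_ge0 u; have := F_le1 v; lra.
have := geu _ y'01 uy'; have := lev _ y'01 vy'.
have := fdag_le' _ v y'oo ltac:(lra); have := fdag_ge_rcdf' _ u y'oo ltac:(lra).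
by rewrite ler_norml; lra.
Qed.

Let sample_bounds (P : interval R) : (forall z, O z -> f z \in P) ->
  \forall k \near \oo, forall y, 0 <= y <= 1 -> fn k y \in P.
Proof.
move=> fP; near=> k => y y01.
apply: lin_spline_bounds => //; first exact: sorted_sorted_samples.
  by rewrite -(ler_nat R); near: k; exact: near_size_large.
by move=> z /sorted_samplesP[p Op ->]; exact: fP.
Unshelve. all: by end_near. Qed.

(** The lower barrier is [q], a bound for all samples below which [F] vanishes. The upper one is a
    non-atom [v < q + e] beyond a point of [ER O f], so that [F v > 0] leaves room near 0. *)
Lemma locally_uniform_cvg0 (q : R) : (forall z, O z -> q <= f z) ->
  q%:E = ess_inf O f -> locally_uniform_cvg 0.
Proof.
move=> qf qE e e0.
have [_ [z ERz <-]] : exists2 r : \bar R, [set z%:E | z in ER O f] r & (r < (q + e)%:E)%E.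
  have := @lb_ereal_inf_adherent _ [set z%:E | z in ER O f] e e0.
  by rewrite -/(ess_inf O f) -qE => /(_ isT).
rewrite lte_fin => zq.
have [v /andP[zv vq] v0] := nonatom_dense O f bdO fcont Ofin z (q + e) zq.
have Fv0 := rcdf_gt0 O f Ofin O0 _ _ ERz zv.
have Fv1 := F_le1 v.
have Fq u : u < q -> F u = 0.
  move=> uq; rewrite /rcdf (_ : [set x | _] = set0) ?leb0 ?mul0r//.
  rewrite -subset0 => p [/qf qp /= fp].
  by have := lt_le_trans uq (le_trans qp fp); rewrite ltxx.
pose c := F v / 2.
have c0 : 0 < c by rewrite divr_gt0.
exists (ball 0 c, [set k | (forall y, 0 <= y <= 1 -> fn k y \in `[q, +oo[) /\
                           (forall y, 0 <= y <= 1 -> y + c <= F v -> fn k y <= v)]) => /=.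
  split; first exact: nbhsx_ballx.
  apply: filterI; last exact: near_spline_le.
  by apply: sample_bounds => z' /qf; rewrite in_itv /= andbT.
move=> [y k] /= [yc [geq lev]] y01.
move: yc; rewrite /ball /= ltr_distlC => /andP[_ yc].
have yv : y + c <= F v by move: yc; rewrite /c; lra.
have := geq _ y01; rewrite in_itv /= andbT; have := lev _ y01 yv.
(* At 0 the value of [fdag] is [q] by definition, and [q <= v] because [F v > 0]. *)
have : q <= fdag O f y <= v.
  have [->|y0] := eqVneq y 0.
    rewrite /fdag eqxx -qE /= lexx /=; rewrite leNgt; apply/negP => /Fq v00.
    by rewrite v00 ltxx in Fv0.
  have yoo : 0 < y < 1.
    by move: y01 yv; rewrite !lt_neqAle eq_sym y0 /= => /andP[-> _]; rewrite -lt_neqAle; lra.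
  apply/andP; split; last by apply: fdag_le' => //; lra.
  by apply: fdag_ge' => // u /Fq ->; case/andP: yoo.
by rewrite ler_norml; lra.
Qed.

(** Mirror image at 1: the upper barrier is [q], where [F q = 1], and the lower one a non-atom
    [u > q - e] below a point of [ER O f], so that [F u < 1]. *)
Lemma locally_uniform_cvg1 (q : R) : (forall z, O z -> f z <= q) ->
  q%:E = ess_sup O f -> locally_uniform_cvg 1.
Proof.
move=> qf qE e e0.
have [_ [z ERz <-]] : exists2 r : \bar R, [set z%:E | z in ER O f] r & ((q - e)%:E < r)%E.
  have := @ub_ereal_sup_adherent _ [set z%:E | z in ER O f] e e0.
  by rewrite -/(ess_sup O f) -qE => /(_ isT).
rewrite lte_fin => qz.
have [u /andP[qu uz] u0] := nonatom_dense O f bdO fcont Ofin (q - e) z qz.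
have Fu1 := rcdf_lt1 O f bdO fcont Ofin O0 _ _ ERz uz.
have Fu0 := F_ge0 u.
have Fq : F q = 1.
  rewrite /rcdf (_ : [set x | _] = O) ?divff ?gt_eqF//.
  by apply/seteqP; split=> [p []|p Op] //; split=> //; exact: qf.
pose c := (1 - F u) / 2.
have c0 : 0 < c by rewrite divr_gt0// subr_gt0.
exists (ball (1 : R) c, [set k | (forall y, 0 <= y <= 1 -> fn k y \in `]-oo, q]) /\
                           (forall y, 0 <= y <= 1 -> F u + c <= y -> u <= fn k y)]) => /=.
  split; first exact: nbhsx_ballx.
  apply: filterI; last exact: near_spline_ge.
  by apply: sample_bounds => z' /qf; rewrite in_itv.
move=> [y k] /= [yc [fnq geu]] y01.
move: yc; rewrite /ball /= ltr_distlC => /andP[yc _].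
have yu : F u + c <= y by move: yc; rewrite /c; lra.
have := fnq _ y01; rewrite in_itv /=; have := geu _ y01 yu.
have : u <= fdag O f y <= q.
  have [->|y1] := eqVneq y 1.
    rewrite /fdag oner_eq0 eqxx -qE /= lexx andbT leNgt; apply/negP => qu'.
    have := le_rcdf O f Ofin O0 _ _ (ltW qu'); rewrite Fq; lra.
  have yoo : 0 < y < 1.
    by rewrite [y < 1]lt_neqAle y1 /=; case/andP: y01 => _ ->; rewrite andbT; lra.
  apply/andP; split; first by apply: fdag_ge_rcdf' => //; lra.
  by apply: fdag_le' => //; rewrite Fq; case/andP: y01.
by rewrite ler_norml; lra.
Qed.

(** Compactness of the segment merges the local thresholds on [k] into one. *)
Lemma uniform_cvg_segment (l r e : R) : 0 <= l -> r <= 1 ->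
  (forall y, l <= y <= r -> locally_uniform_cvg y) -> 0 < e ->
  exists K : nat, forall k : nat, (K <= k)%N ->
    forall y : R, l <= y <= r -> `|fn k y - fdag O f y| <= e.
Proof.
move=> l0 r1 loc e0.
have [K _ KP] : \forall k \near \oo, [set` `[l, r]] `<=`
    [set y | 0 <= y <= 1 -> `|fn k y - fdag O f y| <= e].
  apply: (iffLR (compact_near_coveringP [set` `[l, r]]) (@segment_compact _ l r) nat \oo
    (fun k y => 0 <= y <= 1 -> `|fn k y - fdag O f y| <= e)) => y.
  by rewrite /= in_itv /= => /loc; apply.
exists K => k /KP kP y ylr; apply: kP; rewrite /= ?in_itv//.
by case/andP: ylr; lra.
Qed.

End Convergence.

(* In dimension 0 every box has volume 1 (an empty product), so that [leb] is
   nowhere 0 and no set is regular. *)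
Lemma leb_dim0_ge1 (R : realType) (A : set 'rV[R]_0) : (1 <= leb A)%E.
Proof.
apply: le_ereal_inf_tmp => _ [a [b [_ ->]]].
apply: le_trans (@nneseries_lim_ge _ _ xpredT 0 1 _).
  by rewrite big_nat1 /rvol big_ord0.
by move=> k _ _; rewrite lee_fin rvol_ge0.
Qed.

Theorem theorem3p6 (R : realType) (d : nat) (O : set 'rV[R]_d)
  (f : 'rV[R]_d -> R) (a b : 'rV[R]_d) (nn : nat -> 'I_d -> nat)
  (x : forall k : nat, multi_idx d (nn k) -> 'rV[R]_d) :
  regular_set O -> (0 < leb O)%E ->
  cont_ae O f -> connected (ER O f) ->
  O `<=` rbox a b ->
  (* n(k) -> oo, i.e. min_j n_j(k) -> oo *)
  (forall (j : 'I_d) (M : nat), exists K : nat, forall k : nat,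
      (K <= k)%N -> (M <= nn k j)%N) ->
  (* asymptotically uniform grid in [a,b] *)
  (forall e : R, 0 < e -> exists K : nat, forall k : nat, (K <= k)%N ->
     forall (i : multi_idx d (nn k)) (j : 'I_d),
       `|x k i ord0 j - (a ord0 j + (i j).+1%:R * (b ord0 j - a ord0 j)
                                    / (nn k j)%:R)| <= e) ->
  let fn := fun (k : nat) (y : R) =>
    lin_spline (sorted_samples O f (x k)) y in
  let unif_conv := fun (A : set R) => forall e : R, 0 < e ->
    exists K : nat, forall k : nat, (K <= k)%N ->
      forall y : R, A y -> `|fn k y - fdag O f y| <= e in
  (* 1. *)
  (forall al be : R, 0 < al -> be < 1 ->
     unif_conv [set y | al <= y <= be]) /\
  (* 2. *)
  ((exists M : R, forall z, O z -> M <= f z) ->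
   (inf (f @` O))%:E = ess_inf O f ->
   forall al : R, 0 <= al -> al < 1 -> unif_conv [set y | 0 <= y <= al]) /\
  (* 3. *)
  ((exists M : R, forall z, O z -> f z <= M) ->
   (sup (f @` O))%:E = ess_sup O f ->
   forall al : R, 0 < al -> al <= 1 -> unif_conv [set y | al <= y <= 1]) /\
  (* 4. *)
  ((exists M : R, forall z, O z -> `|f z| <= M) ->
   ER O f = [set z | inf (f @` O) <= z <= sup (f @` O)] ->
   unif_conv [set y | 0 <= y <= 1]).
Proof.
case: d => [|d] in O f a b nn x *.
  move=> [_ bdO]; have := leb_dim0_ge1 R (closure O `\` interior O).
  by rewrite bdO lee_fin ler10.
move=> [_ bdO] O0 fcont cER Oab nn_oo x_unif /=.
have mid := locally_uniform_cvg_oo O f a b nn x bdO O0 fcont cER Oab nn_oo x_unif.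
have left q := locally_uniform_cvg0 O f a b nn x bdO O0 fcont Oab nn_oo x_unif q.
have right q := locally_uniform_cvg1 O f a b nn x bdO O0 fcont Oab nn_oo x_unif q.
have infP M : (forall z, O z -> M <= f z) -> forall z, O z -> inf (f @` O) <= f z.
  move=> Mf z Oz; apply: inf_lbound; last by exists z.
  by exists M => _ [p Op <-]; exact: Mf.
have supP M : (forall z, O z -> f z <= M) -> forall z, O z -> f z <= sup (f @` O).
  move=> fM z Oz; apply: ub_le_sup; last by exists z.
  by exists M => _ [p Op <-]; exact: fM.
split; [|split; [|split]].
- move=> al be al0 be1 e e0; apply: uniform_cvg_segment => //; [lra|lra|].
  by move=> y /andP[y1 y2]; apply: mid; lra.
- move=> [M /infP infO] infE al al0 al1 e e0; apply: uniform_cvg_segment => //; [lra|].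
  move=> y /andP[y0 y1]; have [->|yn0] := eqVneq y 0; first exact: left infO infE.
  by apply: mid; rewrite lt_neqAle eq_sym yn0 y0 /=; lra.
- move=> [M /supP supO] supE al al0 al1 e e0; apply: uniform_cvg_segment => //; [lra|].
  move=> y /andP[y0 y1]; have [->|yn1] := eqVneq y 1; first exact: right supO supE.
  by apply: mid; rewrite [y < 1]lt_neqAle yn1 y1 /= andbT; lra.
- move=> [M fM] ERE e e0.
  have infO : forall z, O z -> inf (f @` O) <= f z.
    by apply: (infP (- M)) => z /fM; rewrite ler_norml => /andP[].
  have supO := supP M (fun z Oz => le_trans (ler_norm _) (fM z Oz)).
  have [p Op] : O !=set0.
    apply/set0P/eqP => O_0; move: O0; rewrite O_0 leb0 ltxx //.
  (* This puts both endpoints in [ER O f], so they are its extreme values and the cases at 0 and 1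
     apply. *)
  have le_is := le_trans (infO p Op) (supO p Op).
  have infE : (inf (f @` O))%:E = ess_inf O f.
    apply/eqP; rewrite eq_le; apply/andP; split.
      by apply: le_ereal_inf_tmp => _ [z + <-]; rewrite ERE lee_fin => /andP[].
    by apply: ereal_inf_lbound; exists (inf (f @` O)) => //; rewrite ERE /= lexx.
  have supE : (sup (f @` O))%:E = ess_sup O f.
    apply/eqP; rewrite eq_le; apply/andP; split; last first.
      by apply: ge_ereal_sup => _ [z + <-]; rewrite ERE lee_fin => /andP[].
    by apply: ereal_sup_ubound; exists (sup (f @` O)) => //; rewrite ERE /= lexx andbT.
  apply: uniform_cvg_segment => // y /andP[y0 y1].
  have [->|yn0] := eqVneq y 0; first exact: left infO infE.
  have [->|yn1] := eqVneq y 1; first exact: right supO supE.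
  by apply: mid; rewrite !lt_neqAle eq_sym yn0 yn1 y0.
Qed.
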